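(* Let $w = w(x_1,\ldots,x_n)$ be a commutator word in the free group $F = \langle x_1,\ldots,x_n\rangle$, i.e. let $w \in [F,F]$. Then every ascending chain $$H_1 \preceq_w H_2 \preceq_w \cdots \preceq_w H_i \preceq_w \cdots$$ of $w$-maximal finite groups is eventually stationary (i.e. there is $i_0$ such that $H_i \cong H_{i_0}$ for all $i \geq i_0$). In particular, if $H$ is a $w$-maximal finite group, then there exists a $w$-maximal finite group $G$ such that $H \preceq_w G$ and $G$ is maximal with respect to the partial ordering $\preceq_w$ (i.e. every $w$-maximal finite group $K$ with $G \preceq_w K$ is isomorphic to $G$).
   Context: For a word $w = w(x_1,\ldots,x_n)$ and a group $G$, the verbal subgroup $w(G)$ is the subgroup of $G$ generated by all values $w(g_1,\ldots,g_n)^{\pm 1}$ with $g_i \in G$. A finite group $G$ is $w$-maximal if $|G:w(G)| > |H:w(H)|$ for all proper subgroups $H$ of $G$. For $w$-maximal groups $G$ and $H$ one writes $H \preceq_w G$ if there exists an epimorphism $f : G \to H$ such that $\ker f \leq w(G)$; this is regarded as a partial ordering on $w$-maximal finite groups up to isomorphism. *)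

(* Defs.v *)
From HB Require Import structures.
From mathcomp Require Import all_boot all_fingroup.

Set Implicit Arguments.
Unset Strict Implicit.
Unset Printing Implicit Defensive.

Local Open Scope group_scope.

(* The free group on x_0, ..., x_(n-1), realised on freely reduced words. *)

(* (i, false) stands for x_i and (i, true) for x_i^-1. *)
Definition letter (n : nat) : Type := ('I_n * bool)%type.
HB.instance Definition _ (n : nat) := Choice.on (letter n).

Definition letter_inv (n : nat) (l : letter n) : letter n := (l.1, ~~ l.2).

Definition reduced (n : nat) (s : seq (letter n)) : bool :=
  sorted (fun l m => m != letter_inv l) s.

Record free_group (n : nat) :=
  FreeGroup { fg_word : seq (letter n); fg_reduced : reduced fg_word }.

HB.instance Definition _ n := [isSub for @fg_word n].
HB.instance Definition _ n := [Choice of free_group n by <:].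

Section FreeGroup.

Variable n : nat.
Implicit Types (l : letter n) (s t u : seq (letter n)).

(* Left multiplication of a reduced word by one letter. *)
Definition fg_push l s : seq (letter n) :=
  if s is m :: s' then if m == letter_inv l then s' else l :: s else [:: l].

(* Concatenation followed by free reduction, for a reduced second argument. *)
Definition fg_cat s t : seq (letter n) := foldr fg_push t s.

Lemma letter_invK : involutive (@letter_inv n).
Proof. by case=> i b; rewrite /letter_inv /= negbK. Qed.

Lemma reduced_behead l s : reduced (l :: s) -> reduced s.
Proof. exact: path_sorted. Qed.

Lemma reduced_push l s : reduced s -> reduced (fg_push l s).
Proof.
case: s => [|m s] //= rs; case: ifPn => [_|ml]; first exact: reduced_behead rs.
by rewrite /reduced /= ml.
Qed.

Lemma reduced_cat s t : reduced t -> reduced (fg_cat s t).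
Proof. by move=> rt; elim: s => //= l s; apply: reduced_push. Qed.

Lemma fg_pushK l s : reduced s -> fg_push l (fg_push (letter_inv l) s) = s.
Proof.
case: s => [|m s] rs /=; first by rewrite eqxx.
rewrite letter_invK; case: eqP => [ml|_] /=; last by rewrite eqxx.
subst m; case: s rs => [|k s] //= /andP[kl _].
by rewrite (negPf kl).
Qed.

Lemma fg_push_cat l s t :
  reduced t -> fg_cat (fg_push l s) t = fg_push l (fg_cat s t).
Proof.
move=> rt; case: s => [|m s] //=; case: eqP => [->|] //=.
by rewrite fg_pushK // reduced_cat.
Qed.

Lemma fg_catA s t u :
  reduced u -> fg_cat s (fg_cat t u) = fg_cat (fg_cat s t) u.
Proof. by move=> ru; elim: s => //= l s ->; rewrite fg_push_cat. Qed.

Lemma fg_cats0 s : reduced s -> fg_cat s [::] = s.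
Proof.
elim: s => //= l s IHs rs; rewrite IHs ?(reduced_behead rs) //.
by case: s rs {IHs} => [|m s] //= /andP[/negPf->].
Qed.

Definition fg_winv s : seq (letter n) := rev [seq letter_inv l | l <- s].

Lemma reduced_winv s : reduced s -> reduced (fg_winv s).
Proof.
rewrite /reduced /fg_winv rev_sorted sorted_map; congr is_true.
case: s => [|l s] //=; elim: s l => [|m s IHs] l //=; rewrite IHs; congr (_ && _).
by rewrite /= letter_invK eq_sym (inv_eq letter_invK).
Qed.

Lemma fg_winvK s : fg_winv (fg_winv s) = s.
Proof.
by rewrite /fg_winv map_rev revK -map_comp map_id_in // => l _; apply: letter_invK.
Qed.

Lemma fg_catVs s : reduced s -> fg_cat (fg_winv s) s = [::].
Proof.
elim: s => //= l s IHs rs; have rs' := reduced_behead rs.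
rewrite /fg_winv /= rev_cons -cats1 /fg_cat foldr_cat /= letter_invK eqxx.
exact: IHs.
Qed.

Definition fg_one : free_group n := @FreeGroup n [::] isT.
Definition fg_mul (v w : free_group n) : free_group n :=
  FreeGroup (reduced_cat (fg_word v) (fg_reduced w)).
Definition fg_inv (w : free_group n) : free_group n :=
  FreeGroup (reduced_winv (fg_reduced w)).

Lemma fg_mulA : associative fg_mul.
Proof. by move=> u v w; apply: val_inj; rewrite /= fg_catA ?fg_reduced. Qed.

Lemma fg_mul1g : left_id fg_one fg_mul.
Proof. by move=> w; apply: val_inj. Qed.

Lemma fg_mulg1 : right_id fg_one fg_mul.
Proof. by move=> w; apply: val_inj; rewrite /= fg_cats0 ?fg_reduced. Qed.

Lemma fg_mulVg : left_inverse fg_one fg_inv fg_mul.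
Proof. by move=> w; apply: val_inj; rewrite /= fg_catVs ?fg_reduced. Qed.

Lemma fg_mulgV : right_inverse fg_one fg_inv fg_mul.
Proof.
move=> w; apply: val_inj => /=; rewrite -{1}(fg_winvK (fg_word w)).
by rewrite fg_catVs ?reduced_winv ?fg_reduced.
Qed.

HB.instance Definition _ := isGroup.Build (free_group n)
  fg_mulA fg_mul1g fg_mulg1 fg_mulVg fg_mulgV.

Definition fg_gen (i : 'I_n) : free_group n := @FreeGroup n [:: (i, false)] isT.

End FreeGroup.

(* [F, F], defined for an arbitrary, possibly infinite, group F. *)
Inductive generated_by (G : groupType) (S : G -> Prop) : G -> Prop :=
| GeneratedMem x : S x -> generated_by S x
| GeneratedOne : generated_by S 1
| GeneratedMul x y : generated_by S x -> generated_by S y -> generated_by S (x * y)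
| GeneratedInv x : generated_by S x -> generated_by S x^-1.

Definition commutator_subgroup (G : groupType) : G -> Prop :=
  generated_by (fun z : G => exists x y : G, z = [~ x, y]).

(* The value w(g_0, ..., g_(n-1)). *)
Definition word_value (n : nat) (gT : groupType) (w : free_group n)
    (g : 'I_n -> gT) : gT :=
  \prod_(l <- fg_word w) (if l.2 then (g l.1)^-1 else g l.1).

Section WordValue.

Variables (n : nat) (gT : groupType) (g : 'I_n -> gT).

(* word_value _ g is the homomorphism from the free group with x_i |-> g i. *)
Lemma word_value_gen (i : 'I_n) : word_value (fg_gen i) g = g i.
Proof. by rewrite /word_value big_seq1. Qed.

Lemma word_valueM (v w : free_group n) :
  word_value (v * w) g = word_value v g * word_value w g.
Proof.
rewrite /word_value /=; elim: (fg_word v) => [|l s IHs] /=.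
  by rewrite big_nil mul1g.
rewrite big_cons -mulgA -IHs; case: (fg_cat s _) => [|m t] /=.
  by rewrite !big_cons.
by case: eqP => [->|_]; rewrite !big_cons //=; case: l.2; rewrite /= ?mulKg ?mulVKg.
Qed.

End WordValue.

Definition verbal_subgroup (n : nat) (w : free_group n) (gT : finGroupType)
    (G : {set gT}) : {set gT} :=
  <<[set word_value w g | g : {ffun 'I_n -> gT} in ffun_on G]>>.

Canonical verbal_subgroup_group (n : nat) (w : free_group n)
  (gT : finGroupType) (G : {set gT}) := [group of verbal_subgroup w G].

Definition w_maximal (n : nat) (w : free_group n) (gT : finGroupType)
    (G : {group gT}) : Prop :=
  forall H : {group gT}, H \proper G ->
    #|H : verbal_subgroup w H| < #|G : verbal_subgroup w G|.

(* w_preceq w H G is H \preceq_w G. *)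
Definition w_preceq (n : nat) (w : free_group n) (hT gT : finGroupType)
    (H : {group hT}) (G : {group gT}) : Prop :=
  exists f : {morphism G >-> hT},
    f @* G = H :> {set hT} /\ 'ker f \subset verbal_subgroup w G.

(* Main.v *)
Require Import Defs.
From mathcomp Require Import all_boot all_fingroup.
From mathcomp Require Import cyclic pgroup sylow maximal.
From Stdlib Require Import Classical_Prop.

(** The order of a [w]-maximal group [G] is bounded by a function of the index
[q = #|G : w(G)|] alone. As [w] is a product of commutators, it takes only the
value 1 on an abelian group, so [w(A) = 1] for every abelian subgroup [A] of
[G], and [w]-maximality gives [#|A| <= q] ([leq_card_abelian_w_maximal]). A
finite group whose abelian subgroups have order at most [q] has bounded order
([leq_card_abelian_bounded]): its prime divisors are at most [q], and a Sylow
subgroup [P] contains a maximal abelian normal subgroup [A], which is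
self-centralising, so that [P / A] embeds in the permutations of [A].

On the other hand [#|G : w(G)|] does not change along [w_preceq], since the
kernel of the epimorphism lies in [w(G)] ([w_preceq_index]). All members of a
chain therefore share one bound on their orders; these orders do not decrease,
so they reach a maximum, from which point every epimorphism of the chain is
injective. In the same way, a [w]-maximal group of largest order among those
above [H] is maximal for [w_preceq]. *)

Set Implicit Arguments.
Unset Strict Implicit.
Unset Printing Implicit Defensive.

Local Open Scope group_scope.

(** * Finite groups with small abelian subgroups *)

(** [P] acts by conjugation on a maximal abelian normal subgroup [A]; since [A]
is its own centraliser in [P], this embeds [P / A] in the symmetric group on
[A]. *)
Lemma leq_card_pgroup_abelian_bounded (q p : nat) (gT : finGroupType)
    (P : {group gT}) :
    p.-group P ->
    (forall A : {group gT}, A \subset P -> abelian A -> #|A| <= q) ->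
  #|P| <= q * q`!.
Proof.
move=> pP bound_abel.
have [|A maxA _] := @maxgroup_exists _ (fun A => (A <| P) && abelian A) 1%G.
  by rewrite normal1 abelian1.
have /SCN_P[/andP[sAP nAP] scA] := max_SCN pP maxA.
have leAq : #|A| <= q.
  by apply: bound_abel => //; have /maxgroupp/andP[] := maxA.
rewrite -(Lagrange sAP) leq_mul //.
apply: leq_trans (_ : #|A|`! <= _); last exact: leq_fact.
have -> : #|P : A| = #|conj_aut A @* P|.
  by rewrite card_morphim ker_conj_aut (setIidPr nAP) -{1}scA indexgI.
rewrite -card_perm; apply: subset_leq_card.
apply: subset_trans (Aut_conj_aut _ _) _.
by apply/subsetP=> a; rewrite inE => /andP[].
Qed.

(** The factor [q * q`!] bounds each Sylow subgroup, and there are at most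
[q.+1] of them up to conjugacy, because every prime divisor is at most [q]. *)
Definition abelian_bound (q : nat) : nat := (q * q`!) ^ q.+1.

(** By Cauchy's theorem a prime divisor of [#|G|] is the order of a cyclic, hence
abelian, subgroup; so few primes occur in the order, and each Sylow subgroup
inherits the hypothesis on abelian subgroups. *)
Lemma leq_card_abelian_bounded (q : nat) (gT : finGroupType)
    (G : {group gT}) :
    (forall A : {group gT}, A \subset G -> abelian A -> #|A| <= q) ->
  #|G| <= abelian_bound q.
Proof.
move=> bound_abel; rewrite /abelian_bound; set b := (q * q`!)%N.
have q_gt0 : 0 < q by have := bound_abel 1%G (sub1G _) (abelian1 _); rewrite cards1.
have b_gt0 : 0 < b by rewrite muln_gt0 q_gt0 fact_gt0.
have leSyl p : p ^ logn p #|G| <= b.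
  rewrite -p_part; have [P sylP] := Sylow_exists p G.
  rewrite -(card_Hall sylP).
  apply: leq_card_pgroup_abelian_bounded (pHall_pgroup sylP) _ => A sAP.
  by apply: bound_abel; apply: subset_trans sAP (pHall_sub sylP).
have size_primes : size (primes #|G|) <= q.+1.
  rewrite -[q.+1](size_iota 0); apply: uniq_leq_size (primes_uniq _) _ => p.
  rewrite mem_primes mem_iota => /and3P[p_pr _ p_dv]; rewrite add0n ltnS.
  have [x Gx <-] := Cauchy p_pr p_dv.
  by rewrite bound_abel ?cycle_subG ?cycle_abelian.
rewrite {1}(prod_prime_decomp (cardG_gt0 G)) prime_decompE big_map /=.
apply: leq_trans (_ : b ^ size (primes #|G|) <= _); last exact: leq_pexp2l.
by elim: (primes _) => [|p s IHs]; rewrite ?big_nil // big_cons expnS leq_mul.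
Qed.

(** * Words and verbal subgroups *)

Lemma word_value1 (n : nat) (gT : groupType) (g : 'I_n -> gT) :
  word_value 1 g = 1.
Proof. exact: big_nil. Qed.

Lemma word_valueV (n : nat) (gT : groupType) (g : 'I_n -> gT) (v : free_group n) :
  word_value v^-1 g = (word_value v g)^-1.
Proof.
by apply: (mulgI (word_value v g)); rewrite -word_valueM !mulgV word_value1.
Qed.

Lemma word_value_in (n : nat) (gT : finGroupType) (G : {group gT})
    (g : 'I_n -> gT) (v : free_group n) :
  (forall i, g i \in G) -> word_value v g \in G.
Proof. by move=> Gg; apply: group_prod => -[i []] _; rewrite ?groupV ?Gg. Qed.

Lemma word_value_morph (n : nat) (aT rT : finGroupType) (G : {group aT})
    (f : {morphism G >-> rT}) (g : 'I_n -> aT) (v : free_group n) :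
  (forall i, g i \in G) -> f (word_value v g) = word_value v (f \o g).
Proof.
move=> Gg; rewrite /word_value morph_prod; last first.
  by move=> -[i []] _; rewrite ?groupV ?Gg.
by apply: eq_bigr => -[i []] _ //=; rewrite morphV.
Qed.

(** Evaluation at a tuple of commuting elements is a homomorphism from the free
group to an abelian group, hence it kills commutators. *)
Lemma commutator_word_value_abelian (n : nat) (w : free_group n)
    (gT : finGroupType) (A : {group gT}) (g : 'I_n -> gT) :
    commutator_subgroup w -> abelian A -> (forall i, g i \in A) ->
  word_value w g = 1.
Proof.
move=> w_comm abA Ag; elim: w_comm => {w} [w [x [y ->]] | | x y _ vx _ vy | x _ vx].
- have cxy : commute (word_value x g) (word_value y g).
    by apply: (centsP abA); apply: word_value_in.
  rewrite /commg /conjg !word_valueM !word_valueV.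
  by rewrite cxy mulKg mulVg.
- exact: word_value1.
- by rewrite word_valueM vx vy mulg1.
- by rewrite word_valueV vx invg1.
Qed.

Lemma verbal_subgroup_abelian (n : nat) (w : free_group n) (gT : finGroupType)
    (A : {group gT}) :
  commutator_subgroup w -> abelian A -> verbal_subgroup w A = 1.
Proof.
move=> w_comm abA; apply/trivgP; rewrite gen_subG.
apply/subsetP=> _ /imsetP[g /ffun_onP Ag ->].
by rewrite inE (commutator_word_value_abelian w_comm abA).
Qed.

Lemma verbal_subgroup_sub (n : nat) (w : free_group n) (gT : finGroupType)
    (G : {group gT}) : verbal_subgroup w G \subset G.
Proof.
rewrite gen_subG; apply/subsetP=> _ /imsetP[g /ffun_onP Gg ->].
exact: word_value_in.
Qed.

Lemma morphim_verbal_subgroup (n : nat) (w : free_group n)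
    (aT rT : finGroupType) (G : {group aT}) (f : {morphism G >-> rT}) :
  f @* verbal_subgroup w G = verbal_subgroup w (f @* G).
Proof.
rewrite morphim_gen; last first.
  by apply: subset_trans (verbal_subgroup_sub w G); apply: subset_gen.
congr <<_>>; apply/setP=> y; apply/idP/idP.
  case/morphimP=> _ _ /imsetP[g /ffun_onP Gg ->] ->.
  rewrite word_value_morph //; apply/imsetP; exists [ffun i => f (g i)].
    by apply/ffun_onP=> i; rewrite ffunE mem_morphim.
  by apply: eq_bigr => -[i b] _; rewrite ffunE.
(* A tuple of elements of the image is lifted coordinatewise to [G]. *)
case/imsetP=> h /ffun_onP fGh ->.
have lift_h i : exists x, (x \in G) && (f x == h i).
  by have /morphimP[x _ Gx ->] := fGh i; exists x; rewrite Gx eqxx.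
have [g /all_and2[Gg fg]] := fin_all_exists (fun i =>
  let: ex_intro x gx := lift_h i in ex_intro _ x (andP gx)).
apply/morphimP; exists (word_value w (finfun g)).
- by apply: word_value_in => i; rewrite ffunE.
- by apply: imset_f; apply/ffun_onP=> i; rewrite ffunE.
rewrite word_value_morph => [|i]; last by rewrite ffunE.
by apply: eq_bigr => -[i b] _ /=; rewrite ffunE (eqP (fg i)).
Qed.

(** * The order on w-maximal groups *)

(** The index of [w(G)] splits as the index of its image, which is [w(H)], times
the index of [w(G)] in the kernel, which is 1. *)
Lemma w_preceq_index (n : nat) (w : free_group n) (hT gT : finGroupType)
    (H : {group hT}) (G : {group gT}) :
  w_preceq w H G -> #|H : verbal_subgroup w H| = #|G : verbal_subgroup w G|.
Proof.
case=> f [fG kerf]; rewrite -{1 2}fG -morphim_verbal_subgroup.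
have := index_morphim_ker f (verbal_subgroup_sub w G) (subxx G).
have /eqP-> : #|'ker_G f : verbal_subgroup w G| == 1%N.
  by rewrite indexg_eq1 subIset // kerf orbT.
by rewrite muln1.
Qed.

Lemma w_preceq_leq_card (n : nat) (w : free_group n) (hT gT : finGroupType)
    (H : {group hT}) (G : {group gT}) :
  w_preceq w H G -> #|H| <= #|G|.
Proof. by case=> f [<- _]; apply: leq_morphim. Qed.

Lemma w_preceq_isog (n : nat) (w : free_group n) (hT gT : finGroupType)
    (H : {group hT}) (G : {group gT}) :
  w_preceq w H G -> #|G| <= #|H| -> G \isog H.
Proof.
case=> f [fG _] leGH; rewrite -fG; apply: sub_isog => //.
by rewrite -card_im_injm eqn_leq leq_morphim fG.
Qed.

Lemma w_preceq_refl (n : nat) (w : free_group n) (gT : finGroupType)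
    (G : {group gT}) : w_preceq w G G.
Proof.
exists [morphism of idm G]; split; first exact: im_idm.
by rewrite ker_idm sub1G.
Qed.

(** The kernel of the composite is the preimage of [ker f], hence lies in the
preimage of [w(G)], which is [ker g * w(K) = w(K)]. *)
Lemma w_preceq_trans (n : nat) (w : free_group n) (hT gT kT : finGroupType)
    (H : {group hT}) (G : {group gT}) (K : {group kT}) :
  w_preceq w H G -> w_preceq w G K -> w_preceq w H K.
Proof.
case=> f [fG kerf] [g [gK kerg]].
have sub_dom : K \subset g @*^-1 G by rewrite -sub_morphim_pre ?gK.
exists (restrm_morphism sub_dom (comp_morphism g f)); split.
  by rewrite morphim_restrm setIid morphim_comp gK.
rewrite ker_restrm ker_comp subIset //; apply/orP; right.
apply: subset_trans (morphpreS _ kerf) _.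
have <- : g @* verbal_subgroup w K = verbal_subgroup w G.
  by rewrite morphim_verbal_subgroup gK.
rewrite morphimK ?verbal_subgroup_sub //.
by rewrite mul_subG.
Qed.

(** An abelian subgroup [A] has trivial verbal subgroup, so [#|A : w(A)|] is the
order of [A]. *)
Lemma leq_card_abelian_w_maximal (n : nat) (w : free_group n)
    (gT : finGroupType) (G A : {group gT}) :
    commutator_subgroup w -> w_maximal w G -> A \subset G -> abelian A ->
  #|A| <= #|G : verbal_subgroup w G|.
Proof.
move=> w_comm maxG sAG abA.
rewrite -(indexg1 A) -(verbal_subgroup_abelian w_comm abA).
have [eqAG|neqAG] := eqVneq A G; first by rewrite eqAG.
by apply: ltnW; apply: maxG; rewrite properEneq neqAG.
Qed.

Lemma leq_card_w_maximal (n : nat) (w : free_group n) (gT : finGroupType)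
    (G : {group gT}) :
    commutator_subgroup w -> w_maximal w G ->
  #|G| <= abelian_bound #|G : verbal_subgroup w G|.
Proof.
move=> w_comm maxG; apply: leq_card_abelian_bounded => A.
exact: leq_card_abelian_w_maximal.
Qed.

Lemma bounded_pred_has_max (P : nat -> Prop) (b n0 : nat) :
    P n0 -> (forall n, P n -> n <= b) ->
  exists2 m, P m & forall n, P n -> n <= m.
Proof.
move=> Pn0 leb; have [k] := ubnP (b - n0)%N.
elim: k n0 Pn0 => // k IHk n0 Pn0; rewrite ltnS => le_k.
have [[m [Pm lt_n0m]] | no_larger] := classic (exists m, P m /\ n0 < m).
  apply: (IHk m Pm); apply: leq_trans le_k.
  by rewrite ltn_sub2l //; apply: leq_trans (leb _ Pm).
exists n0 => // n Pn; rewrite leqNgt; apply/negP=> lt_n0n.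
by apply: no_larger; exists n.
Qed.

Theorem corollary2p4 (n : nat) (w : free_group n)
    (hw : commutator_subgroup w) :
  (forall (gT : nat -> finGroupType) (H : forall i : nat, {group gT i}),
     (forall i : nat, w_maximal w (H i)) ->
     (forall i : nat, w_preceq w (H i) (H i.+1)) ->
     exists i0 : nat, forall i : nat, i0 <= i -> H i \isog H i0)
  /\
  (forall (hT : finGroupType) (H : {group hT}), w_maximal w H ->
     exists (gT : finGroupType) (G : {group gT}),
       [/\ w_maximal w G, w_preceq w H G &
           forall (kT : finGroupType) (K : {group kT}),
             w_maximal w K -> w_preceq w G K -> K \isog G]).
Proof.
split=> [gT H maxH leH | hT H maxH].
  have leH_chain i j : i <= j -> w_preceq w (H i) (H j).
    move=> /subnKC <-; elim: (j - i)%N => [|k IHk].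
      by rewrite addn0; apply: w_preceq_refl.
    by rewrite addnS; apply: w_preceq_trans IHk (leH _).
  have [_ [i0 ->] max_i0] : exists2 m, (exists i, m = #|H i|) &
      forall k, (exists i, k = #|H i|) -> k <= m.
    apply: (@bounded_pred_has_max _ (abelian_bound #|H 0 : verbal_subgroup w (H 0)|)
             #|H 0|); first by exists 0.
    move=> _ [i ->]; rewrite (w_preceq_index (leH_chain 0 i _)) //.
    exact: leq_card_w_maximal.
  exists i0 => i le_i0i; apply: (w_preceq_isog (leH_chain _ _ le_i0i)).
  by apply: max_i0; exists i.
pose above m := exists (gT : finGroupType) (G : {group gT}),
  [/\ w_maximal w G, w_preceq w H G & m = #|G|].
have [_ [gT [G [maxG leHG ->]]] max_G] : exists2 m, above m &
    forall k, above k -> k <= m.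
  apply: (@bounded_pred_has_max _ (abelian_bound #|H : verbal_subgroup w H|) #|H|).
    by exists hT, H; split=> //; apply: w_preceq_refl.
  move=> _ [gT [G [maxG leHG ->]]]; rewrite (w_preceq_index leHG).
  exact: leq_card_w_maximal.
exists gT, G; split=> // kT K maxK leGK; apply: (w_preceq_isog leGK).
by apply: max_G; exists kT, K; split=> //; apply: w_preceq_trans leGK.
Qed.
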